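(* Let $L$ be a finite lattice and let $a_1,a_2,\ldots,a_m$ be distinct elements of $L$ such that there is $b\in L$ with $a_i\wedge a_j=b$ for all distinct $i,j\in[m]$, and such that for each $i\in[m-1]$ there is a lattice isomorphism $\tau_{m,i}:[\hat{0},a_m]\to[\hat{0},a_i]$ with $\tau_{m,i}(y)=y$ for all $y\in[\hat{0},b]$. Let $L_1,\ldots,L_n$ be finite lattices, disjoint from each other and from $L$, and let $s:[n]\to[m]$ and $t:[n]\to[m]$ be functions. Form the lattice $L_s$ as follows: for each $i\in[n]$, let $L_i'$ be obtained from $L_i$ by replacing $\hat{1}_{L_i}$ by $\hat{1}_L$ and $\hat{0}_{L_i}$ by $a_{s(i)}$; viewing lattices as order relations, $L_s$ is the transitive closure of $L\cup L_1'\cup\cdots\cup L_n'$ (i.e., each $L_i$ is inserted into the interval $[a_{s(i)},\hat{1}_L]$ with its bottom identified with $a_{s(i)}$ and its top with $\hat{1}_L$). Define $L_t$ in the same way using $t$ in place of $s$; thus $L_s$ and $L_t$ have the same underlying set. Let $M_s$ and $M_t$ be matroids with rank functions $r_s$ and $r_t$, neither having loops or coloops, and suppose there are lattice isomorphisms $\phi_s:L_s\to\mathcal{Z}(M_s)$ and $\phi_t:L_t\to\mathcal{Z}(M_t)$ such that (1) $|\phi_s(y)|=|\phi_t(y)|$ and $r_s(\phi_s(y))=r_t(\phi_t(y))$ for all $y$ in $L_s$, and (2) if $y\in[\hat{0},a_m]$, then $|\phi_s(y)|=|\phi_s(\tau_{m,i}(y))|$ and $r_s(\phi_s(y))=r_s(\phi_s(\tau_{m,i}(y)))$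 for all $i\in[m-1]$. Then $\mathcal{G}(M_s)=\mathcal{G}(M_t)$.
   Context: All matroids are finite. A cyclic flat of a matroid $M$ is a flat that is a (possibly empty) union of circuits; the cyclic flats ordered by inclusion form a lattice $\mathcal{Z}(M)$ (join of $X,Y$ is $\mathrm{cl}(X\cup Y)$, meet is $X\cap Y$ with the coloops of $M|(X\cap Y)$ removed). For a matroid $M$ on an $n$-element set $E$ of rank $k$ and a permutation $e_1,\ldots,e_n$ of $E$, the rank sequence is $r_1r_2\cdots r_n$ with $r_i=r(\{e_1,\ldots,e_i\})-r(\{e_1,\ldots,e_{i-1}\})$. For each sequence $\underline{r}$ of $k$ ones and $n-k$ zeros let $[\underline{r}]$ be a formal symbol; the $\mathcal{G}$-invariant of $M$ is the formal sum $\mathcal{G}(M)=\sum_{\pi}[\underline{r}(\pi)]$ over all permutations $\pi$ of $E$, an element of the vector space (over a field of characteristic zero) with basis these symbols. $[x,y]$ denotes an interval in a lattice, $\hat 0,\hat 1$ the least and greatest elements. *)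

(* Defs.v *)
From HB Require Import structures.
From mathcomp Require Import all_boot all_order all_algebra.
From mathcomp.multinomials Require Import freeg.

Set Implicit Arguments.
Unset Strict Implicit.
Unset Printing Implicit Defensive.

Import Order.TTheory GRing.Theory.

(* An isomorphism of lattices given by their order relations is an order      *)
(* isomorphism.                                                               *)
Definition order_iso (T U : Type) (leT : rel T) (leU : rel U) (f : T -> U) :=
  bijective f /\ {mono f : x y / leT x y >-> leU x y}.

Section Intervals.
Variables (d : Order.disp_t) (L : finTBLatticeType d).

Definition interval_type (x y : L) : Type := {z : L | (x <= z <= y)%O}.

Definition interval_le (x y : L) : rel (interval_type x y) :=
  fun u v => (val u <= val v)%O.

End Intervals.

(* The lattices K i are inserted in the intervals [p i, \top] of L.           *)
Section Insertion.
Variables (d : Order.disp_t) (L : finTBLatticeType d) (n : nat).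
Variables (dK : 'I_n -> Order.disp_t).
Variables (K : forall i, finTBLatticeType (dK i)).

Definition inner (i : 'I_n) : finType := {x : K i | (\bot < x < \top)%O}.

(* The elements of L and, as a disjoint union, the elements of each K i other *)
(* than its bottom and its top, which become elements of L. The type does not *)
(* depend on p.                                                               *)
Definition insertion : finType := (L + {i : 'I_n & inner i})%type.

Definition old (x : L) : insertion := inl x.

Variable p : 'I_n -> L.

(* If K i has only one element then that element is sent to the top of L, so  *)
(* that inserting K i changes nothing.                                        *)
Definition relabel (i : 'I_n) (x : K i) : insertion :=
  if insub x is Some z then inr (existT (fun j => inner j : Type) i z)
  else if x == \top%O then old \top%O else old (p i).

Definition union_le : rel insertion := fun u v =>
  [exists x : L, exists y : L, [&& u == old x, v == old y & (x <= y)%O]]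
  || [exists i : 'I_n, exists x : K i, exists y : K i,
        [&& u == relabel x, v == relabel y & (x <= y)%O]].

(* union_le is reflexive, so its reflexive transitive closure is its          *)
(* transitive closure.                                                        *)
Definition insertion_le : rel insertion := connect union_le.

End Insertion.

Record matroid (E : finType) := Matroid {
  rk : {set E} -> nat;
  rk_le_card : forall A : {set E}, rk A <= #|A|;
  rk_mono : forall A B : {set E}, A \subset B -> rk A <= rk B;
  rk_submodular : forall A B : {set E}, rk (A :|: B) + rk (A :&: B) <= rk A + rk B
}.

Section Matroids.
Variables (E : finType) (M : matroid E).

Definition indep (A : {set E}) : bool := rk M A == #|A|.

Definition basis (B : {set E}) : bool := maxset indep B.

Definition circuit (C : {set E}) : bool := minset [pred A | ~~ indep A] C.

Definition cl (A : {set E}) : {set E} := [set x | rk M (x |: A) == rk M A].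

Definition flat (A : {set E}) : bool := cl A == A.

Definition cyclic_flat (A : {set E}) : bool :=
  flat A && [exists P : {set {set E}}, [forall C in P, circuit C] && (cover P == A)].

Definition is_loop (x : E) : bool := circuit [set x].

Definition is_coloop (x : E) : bool := [forall B, basis B ==> (x \in B)].

Definition cyclic_flats : Type := {A : {set E} | cyclic_flat A}.

Definition cyclic_flats_le : rel cyclic_flats :=
  fun X Y => val X \subset val Y.

Definition rank_seq (e : seq E) : seq nat :=
  mkseq (fun i => rk M [set x in take i.+1 e] - rk M [set x in take i e])
        (size e).

(* The permutations of E are the duplicate-free tuples of length #|E|. The    *)
(* space has all finite sequences of naturals as basis, hence contains the    *)
(* spaces spanned by the sequences of k ones and n - k zeros for all n and k, *)
(* so that matroids on different ground sets can be compared.                 *)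
Definition G_invariant (F : fieldType) : {freeg (seq nat) / F} :=
  (\sum_(e : #|E|.-tuple E | uniq e) << rank_seq e >>)%R.

End Matroids.

Arguments old {d L n dK} K x.
Arguments insertion {d} L {n dK} K.
Arguments insertion_le {d L n dK} K p.

(* Main.v *)
(* Both sides are computed from the chains of cyclic flats. For a chain C of   *)
(* cyclic flats, min_(G in C) r(G) + |S \ G| is the rank of S in the nested    *)
(* (Schubert) matroid of C, and the number of permutations with a given rank   *)
(* sequence in that matroid depends only on the set of pairs (|G|, r(G)), G in *)
(* C. The indicator of a rank sequence of M at a permutation is the sum over   *)
(* the chains A of the alternating sum, over C included in A, of the same      *)
(* indicators for the nested matroids. Hence G(M) depends only on the number   *)
(* of chains with each set of pairs. A chain of L_s either lies in L or        *)
(* contains new elements of exactly one K_i, and then all its elements of L    *)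
(* other than the top lie below a_(s i); moving these below a_(t i) by the     *)
(* isomorphisms tau gives a chain of L_t with the same pairs.                  *)

Require Import Defs.
From mathcomp Require Import all_boot all_order all_algebra.
From mathcomp.multinomials Require Import freeg.
From mathcomp Require Import zify.

Set Implicit Arguments.
Unset Strict Implicit.
Unset Printing Implicit Defensive.

Import Order.TTheory GRing.Theory Num.Theory.

(** The rank of [S] is the minimum of [r(G) + |S \ G|] over all cyclic flats [G]; the nested matroid
    of a chain takes this minimum over the chain only. [altsum] is Möbius inversion on subsets, so
    if the cyclic flats formed a single chain, then [chainsum], which adds it over all chains, would
    return the value on the whole chain. For the rank sequence of one permutation it returns the
    right value in general: [chainsumU1] adjoins a flat [F] to every chain when each flat not below
    [F] is made redundant by its meet with [F], and [chainsum_chain_rank] adjoins in this way, for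
    every initial segment, the cyclic flat that attains its rank. The summand is then constant.
    Summing over permutations gives [rank_seq_count].

    A summand depends only on the pairs (size, rank) of the flats in a chain, because nested
    families with the same sizes are carried to each other by a bijection of the ground sets
    ([chain_bijection], [chain_count_transport]). It remains to match the chains of the two lattices
    by maps that preserve these pairs elementwise, so that subsets of chains are matched as well;
    this is [chain_mapP], which rests on the explicit order in [insertion_leE]. *)

(** * Alternating sums over subsets *)

Section AlternatingSum.
Variable T : finType.
Implicit Types (V : {set T} -> int) (A C : {set T}) (x y : T).
Local Open Scope ring_scope.

Definition altsum V A : int := \sum_(C : {set T} | C \subset A) (-1) ^+ #|A :\: C| * V C.

Lemma eq_altsum V1 V2 A :
  (forall C, C \subset A -> V1 C = V2 C) -> altsum V1 A = altsum V2 A.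
Proof. by move=> eqV; apply: eq_bigr => C /eqV->. Qed.

Lemma altsum0 V : altsum V set0 = V set0.
Proof.
rewrite /altsum (big_pred1 set0) => [|C]; last by rewrite subset0.
by rewrite set0D cards0 expr0 mul1r.
Qed.

(** Subsets of [x |: A] are split by membership of [x]; those without [x] miss one more element,
    hence the minus sign. *)
Lemma altsumU1 V A x : x \notin A ->
  altsum V (x |: A) = altsum (fun C => V (x |: C)) A - altsum V A.
Proof.
move=> xA; rewrite /altsum (bigID (fun C : {set T} => x \in C)) /=; congr (_ + _).
  rewrite (reindex_onto (fun C => x |: C) (fun C => C :\ x)) /=; last first.
    by move=> C /andP[_ xC]; rewrite setD1K.
  apply: eq_big => [C|C /andP[/andP[_ _]]].
    rewrite setU11 andbT; apply/andP/idP => [[/subsetP sC /eqP eC]|sC].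
      rewrite -eC; apply/subsetP => z; rewrite !inE => /andP[zx].
      move=> /orP[/eqP zx'|zC]; first by rewrite zx' eqxx in zx.
      by have := sC z; rewrite !inE zC orbT (negPf zx) /= => /(_ isT).
    rewrite setUS // setU1K //.
    by apply: contra xA; move/(subsetP sC).
  move=> /eqP eC; congr ((-1) ^+ _ * _); apply: eq_card => z; rewrite !inE.
  by case: (eqVneq z x) => [->|]; rewrite //= (negPf xA) andbF.
rewrite -sumrN; apply: eq_big => [C|C /andP[sC xC]].
  apply/andP/idP => [[/subsetP sC xC]|sC].
    apply/subsetP => z zC; have := sC z zC; rewrite !inE => /orP[/eqP zx|//].
    by rewrite -zx zC in xC.
  split; first by rewrite (subset_trans sC) // subsetUr.
  by apply: contra xA; move/(subsetP sC).
rewrite -mulNr -[(- (_ ^+ _))]mulN1r -exprS; congr ((-1) ^+ _ * _).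
have -> : (x |: A) :\: C = x |: (A :\: C).
  apply/setP => z; rewrite !inE.
  by case: (eqVneq z x) => [->|] /=; rewrite ?xC.
by rewrite cardsU1 !inE (negPf xA) andbF.
Qed.

Lemma altsum_eq0 V A x : x \in A ->
  (forall C, C \subset A -> V (x |: C) = V C) -> altsum V A = 0.
Proof.
move=> xA Vx; rewrite -(setD1K xA) altsumU1 ?setD11 //.
rewrite (@eq_altsum _ V) ?subrr // => C sC.
by rewrite Vx // (subset_trans sC) // subsetDl.
Qed.

Lemma altsum_const (c : int) A : altsum (fun=> c) A = if A == set0 then c else 0.
Proof.
have [->|/set0Pn[x xA]] := eqVneq; first exact: altsum0.
exact: (@altsum_eq0 _ _ x).
Qed.

(** Once [x] is present [V] ignores [y], so the subsets containing [x] cancel in pairs. This sign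
    change drives the cancellation between chains. *)
Lemma altsum_toggle V A x y : x \notin A -> y \in A ->
  (forall C, V (y |: (x |: C)) = V (x |: C)) -> altsum V (x |: A) = - altsum V A.
Proof.
move=> xA yA Vyx; rewrite altsumU1 // (@altsum_eq0 _ _ y) ?sub0r // => C _.
by rewrite setUCA Vyx.
Qed.

End AlternatingSum.

Lemma altsum_imset (T U : finType) (V : {set U} -> int) (f : T -> U) (A : {set T}) :
  {in A &, injective f} ->
  altsum V (f @: A) = altsum (fun C : {set T} => V (f @: C)) A.
Proof.
have [k] := ubnP #|A|; elim: k V A => // k IH V A.
have [->|/set0Pn[x xA]] := eqVneq A set0.
  by rewrite imset0 !altsum0 imset0.
move=> cA injf; rewrite -(setD1K xA) imsetU1 !altsumU1 ?setD11 //; last first.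
  apply/imsetP => -[z]; rewrite !inE => /andP[zx zA] /injf ezx.
  by rewrite ezx ?eqxx in zx.
have injA : {in A :\ x &, injective f}.
  by move=> u v /setD1P[_ uA] /setD1P[_ vA]; apply: injf.
rewrite !IH //; try by move: cA; rewrite (cardsD1 x A) xA; lia.
congr (_ - _)%R; apply: eq_altsum => C _; by rewrite imsetU1.
Qed.

(** * Sums over chains, and adjoining one element to every chain *)

Section Chains.
Variables (T : finType) (le : rel T).
Hypotheses (le_refl : reflexive le) (le_trans : transitive le).
Implicit Types (V : {set T} -> int) (A C : {set T}) (x y : T).

Definition is_chain A := [forall x in A, forall y in A, le x y || le y x].

Lemma is_chainP A : reflect {in A &, forall x y, le x y || le y x} (is_chain A).
Proof.
apply: (iffP forall_inP) => [chA x y xA yA|chA x xA]; last first.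
  by apply/forall_inP => y; apply: chA.
by have /forall_inP/(_ y yA) := chA x xA.
Qed.

Lemma is_chain_sub A C : C \subset A -> is_chain A -> is_chain C.
Proof.
by move=> /subsetP sCA /is_chainP chA; apply/is_chainP => x y /sCA xA /sCA; apply: chA.
Qed.

Lemma is_chainU1 A x :
  is_chain A -> {in A, forall z, le x z || le z x} -> is_chain (x |: A).
Proof.
move=> /is_chainP chA xA; apply/is_chainP => y z.
move=> /setU1P[->|yA] /setU1P[->|zA]; [by rewrite le_refl|exact: xA| |exact: chA].
by rewrite orbC xA.
Qed.

Definition chainsum V : int := (\sum_(A : {set T} | is_chain A) altsum V A)%R.

(** The alternating sum of a constant vanishes on every nonempty chain. *)
Lemma chainsum_const (c : int) : chainsum (fun=> c) = c.
Proof.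
rewrite /chainsum (bigD1 set0) /=; last by apply/is_chainP => x y; rewrite inE.
rewrite altsum_const eqxx big1 ?addr0 // => A /andP[_ /negPf A0].
by rewrite altsum_const A0.
Qed.

Variables (F : T) (m : T -> T).
Hypotheses (m_lel : forall y, le (m y) y) (m_ler : forall y, le (m y) F)
  (m_glb : forall z y, le z y -> le z F -> le z (m y)).

Let above A := [set z in A | ~~ le z F].
Let lowest A := [pick y in above A | [forall z in above A, le y z]].
Let toggle x A := if x \in A then A :\ x else x |: A.

Let toggleK x : involutive (toggle x).
Proof.
move=> A; rewrite /toggle; have [xA|xA] := boolP (x \in A).
  by rewrite setD11 setD1K.
by rewrite setU11 setU1K.
Qed.

Let lowestP A : is_chain A -> above A != set0 ->
  exists2 y, lowest A = Some y
    & [/\ y \in A, ~~ le y F & {in A, forall z, ~~ le z F -> le y z}].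
Proof.
move=> /is_chainP chA; rewrite /lowest; case: pickP => [y|no] /=.
  rewrite !inE => /andP[/andP[yA yF] /forall_inP ymin] _; exists y => //.
  by split=> // z zA zF; apply: ymin; rewrite !inE zA.
move=> /set0Pn[x0 x0A]; exfalso.
(* Among comparable elements, one with the fewest elements below it is a least one. *)
have [y yA ymin] := arg_minnP (fun y => #|[set z | le z y]|) x0A.
have /negP := no y; apply; apply/andP; split; first exact: yA.
apply/forall_inP => z zA.
have /[!inE]/andP[yA' _] : y \in above A := yA.
have /[!inE]/andP[zA' _] : z \in above A := zA.
have /orP[//|lzy] := chA y z yA' zA'.
have [//|nyz] := boolP (le y z); have /eqP : [set u | le u z] == [set u | le u y].
  rewrite eqEcard ymin // andbT; apply/subsetP => u; rewrite !inE => luz.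
  exact: le_trans luz lzy.
by move=> /setP/(_ y); rewrite !inE le_refl (negPf nyz).
Qed.

Let redundant V := forall y C, ~~ le y F -> V (y |: (m y |: C)) = V (m y |: C).

(* Let y be the least element of A not below F. Toggling m y in A is an        *)
(* involution on these chains and, as m y makes y redundant, changes the sign  *)
(* of the alternating sum.                                                     *)
Let chainsum_above V : redundant V ->
  (\sum_(A : {set T} | is_chain A && (above A != set0)) altsum V A = 0)%R.
Proof.
(* The default [F] keeps [mu A] below [F] for every set [A], so toggling it never changes [above A],
   and [inv] is an involution on all sets. *)
move=> redV; pose mu A := if lowest A is Some y then m y else F.
have mu_le A : le (mu A) F by rewrite /mu; case: lowest.
pose inv A := toggle (mu A) A.
have aboveE A : above (inv A) = above A.
  apply/setP => z; rewrite !inE /inv /toggle.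
  case: (eqVneq z (mu A)) => [->|zm]; first by rewrite mu_le !andbF.
  by case: ifP => _; rewrite !inE ?zm ?(negPf zm).
have muE A : mu (inv A) = mu A by rewrite /mu /lowest aboveE.
have invK : involutive inv by move=> A; rewrite {1}/inv muE /inv toggleK.
have chinv A : is_chain A -> above A != set0 -> is_chain (inv A).
  move=> chA nA; have [y low [yA yF ymin]] := lowestP chA nA.
  rewrite /inv /toggle; case: ifP => _; first exact: is_chain_sub (subsetDl _ _) chA.
  apply: is_chainU1 => // z zA; rewrite /mu low.
  have [zF|zF] := boolP (le z F); last by rewrite (le_trans (m_lel y)) ?ymin.
  have /is_chainP/(_ y z yA zA)/orP[yz|zy] := chA.
    by rewrite (le_trans yz zF) in yF.
  by rewrite (m_glb zy zF) orbT.
set S := (\sum_(_ | _) _)%R.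
suff : S = (- S)%R by lia.
rewrite {1}/S (reindex_inj (inv_inj invK)) /= -sumrN.
apply: eq_big => [A|A]; rewrite aboveE.
  case nA: (above A != set0); rewrite ?andbF ?andbT //.
  apply/idP/idP => chA; last exact: chinv.
  by rewrite -(invK A) chinv // aboveE.
case nA: (above A != set0); rewrite ?andbF ?andbT // => chA'.
have chA : is_chain A by rewrite -(invK A) chinv // aboveE.
have [y low [yA yF _]] := lowestP chA nA.
rewrite /inv /mu low /toggle.
have ny : m y != y by apply: contra yF => /eqP<-.
case: ifP => mA.
  rewrite -{2}(setD1K mA) (@altsum_toggle _ _ _ _ y) ?opprK ?setD11 //.
    by rewrite !inE eq_sym ny.
  by move=> C; apply: redV.
by rewrite (@altsum_toggle _ _ _ _ y) ?mA // => C; apply: redV.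
Qed.

(** Chains with an element not below [F] cancel on both sides. Of the others, [A] without [F] is
    paired with [F |: A]: by [altsumU1] their two sums on the left add up to the sum at [A] on the
    right, where chains through [F] contribute zero. *)
Lemma chainsumU1 V : redundant V -> chainsum V = chainsum (fun C => V (F |: C)).
Proof.
move=> redV; rewrite /chainsum.
rewrite (bigID (fun A => above A != set0)) /= chainsum_above // add0r.
rewrite [RHS](bigID (fun A => above A != set0)) /= chainsum_above ?add0r; last first.
  by move=> y C yF; rewrite [F |: (y |: _)]setUCA (setUCA [set F] [set m y]) redV.
rewrite (bigID (fun A => F \in A)) /= [RHS](bigID (fun A => F \in A)) /=.
rewrite [X in (_ = X + _)%R]big1 ?add0r => [|A /andP[_ FA]]; last first.
  by apply: (altsum_eq0 FA) => C _; rewrite setUA setUid.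
rewrite (reindex_onto (fun A => F |: A) (fun A => A :\ F)) /=; last first.
  by move=> A /andP[_ FA]; rewrite setD1K.
have aboveF A : above (F |: A) = above A.
  by apply/setP => z; rewrite !inE; case: (eqVneq z F) => [->|//]; rewrite le_refl !andbF.
rewrite (eq_bigl (fun A => is_chain A && ~~ (above A != set0) && (F \notin A))); last first.
  move=> A; rewrite aboveF setU11 andbT -!andbA !negbK.
  have -> : ((F |: A) :\ F == A) = (F \notin A).
    apply/eqP/idP => [<-|FA]; first by rewrite setD11.
    by rewrite setU1K.
  case: (eqVneq (above A) set0) => [a0|]; rewrite ?andbF //=.
  case: (F \notin A); rewrite ?andbF ?andbT //.
  apply/idP/idP; first exact/is_chain_sub/subsetUr.
  move=> chA; apply: is_chainU1 => // z zA; rewrite orbC.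
  by have /setP/(_ z) := a0; rewrite !inE zA /= => /negbT; rewrite negbK => ->.
rewrite -big_split /=; apply: eq_bigr => A /andP[_ FA].
by rewrite altsumU1 // subrK.
Qed.

End Chains.

(** * Coloops of restrictions, closure and cyclic flats *)

Section MatroidTheory.
Variables (E : finType) (M : matroid E).
Implicit Types (A B C X Y S : {set E}) (x y : E).
Local Notation r := (rk M).

Lemma rk_set0 : r set0 = 0.
Proof. by apply/eqP; rewrite -leqn0 -(cards0 E) rk_le_card. Qed.

Lemma rk_setU A B : r (A :|: B) <= r A + #|B :\: A|.
Proof.
have := rk_submodular M A (B :\: A).
rewrite setDE setUIr setUCr setIT -setDE setIDA setDIl setDv set0I rk_set0 addn0.
by move/leq_trans; apply; rewrite leq_add2l rk_le_card.
Qed.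

Lemma rk_setD A B : r A <= r (A :\: B) + #|A :&: B|.
Proof.
have := rk_setU (A :\: B) (A :&: B); rewrite setUC setID.
by move/leq_trans; apply; rewrite leq_add2l subset_leq_card // subsetDl.
Qed.

Lemma rk_le_flat A X : r A <= r X + #|A :\: X|.
Proof. by apply: leq_trans (rk_setU X A); rewrite rk_mono // subsetUr. Qed.

(** Submodularity for [A] and [B :\ x], whose union is [B]: non-coloops of a restriction remain so
    in larger restrictions. *)
Lemma rk_setD_subset A B x : x \in A -> A \subset B -> r (A :\ x) = r A -> r (B :\ x) = r B.
Proof.
move=> xA sAB rAx; apply/eqP; rewrite eqn_leq rk_mono ?subsetDl //=.
have := rk_submodular M A (B :\ x).
have -> : A :|: B :\ x = B.
  apply/setP => z; rewrite !inE; case: (eqVneq z x) => [->|_] /=.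
    by rewrite orbF xA (subsetP sAB).
  by have := subsetP sAB z; case: (z \in A) => // ->.
have -> : A :&: (B :\ x) = A :\ x by rewrite setIDA (setIidPl sAB).
by rewrite rAx addnC leq_add2l.
Qed.

(** This is the union of the circuits contained in [A], described through the coloops of the
    restriction to [A]. *)
Definition cyclic_part A := [set x in A | r (A :\ x) == r A].

Lemma cyclic_part_sub A : cyclic_part A \subset A.
Proof. by apply/subsetP => x; rewrite inE => /andP[]. Qed.

Lemma cyclic_partS A B : A \subset B -> cyclic_part A \subset cyclic_part B.
Proof.
move=> sAB; apply/subsetP => x; rewrite !inE => /andP[xA /eqP rAx].
by rewrite (subsetP sAB) //= (rk_setD_subset xA sAB rAx).
Qed.

(** The coloops are removed one at a time; by [rk_setD_subset] those left are still coloops of what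
    remains, so each removal costs exactly one. *)
Lemma rk_setD_coloops A S :
  S \subset A -> [disjoint S & cyclic_part A] -> r (A :\: S) + #|S| = r A.
Proof.
have [k] := ubnP #|S|; elim: k S => // k IH S cS sSA dSA.
have [->|/set0Pn[x xS]] := eqVneq S set0; first by rewrite setD0 cards0 addn0.
have xA := subsetP sSA x xS.
have cx : r (A :\ x) < r A.
  have : x \notin cyclic_part A by rewrite (disjointFr dSA).
  by rewrite inE xA /= ltn_neqAle rk_mono ?subsetDl ?andbT.
have cS' : #|S| = (#|S :\ x|).+1 by rewrite (cardsD1 x S) xS.
have sS' : S :\ x \subset A := subset_trans (subsetDl _ _) sSA.
have := IH (S :\ x); rewrite -ltnS -cS' => /(_ cS sS' (disjointWl (subsetDl _ _) dSA)) IHS.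
rewrite cS' -IHS addnS -addSn; congr (_ + _); apply/eqP; rewrite eqn_leq.
have eD : (A :\: (S :\ x)) :\ x = A :\: S.
  by apply/setP => z; rewrite !inE; case: (eqVneq z x) => [->|] //=; rewrite xS.
have := rk_setD (A :\: (S :\ x)) [set x]; rewrite eD.
have cI : #|(A :\: (S :\ x)) :&: [set x]| <= 1.
  by rewrite -(cards1 x) subset_leq_card ?subsetIr.
suff : r (A :\: S) <> r (A :\: (S :\ x)).
  have : r (A :\: S) <= r (A :\: (S :\ x)) by rewrite -eD rk_mono ?subsetDl.
  by move: cI; lia.
move=> e; move: cx; rewrite ltnNge => /negP; apply.
rewrite (@rk_setD_subset (A :\: (S :\ x)) A) ?subsetDl ?eD //.
by rewrite !inE eqxx.
Qed.

Lemma rk_cyclic_part A : r (cyclic_part A) + #|A :\: cyclic_part A| = r A.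
Proof.
have <- := @rk_setD_coloops A (A :\: cyclic_part A); rewrite ?subsetDl //.
  by rewrite setDDr setDv set0U (setIidPr (cyclic_part_sub A)).
by rewrite disjoint_sym disjoints_subset setCD subsetUr.
Qed.

Lemma cyclic_part_id A : cyclic_part (cyclic_part A) = cyclic_part A.
Proof.
apply/eqP; rewrite eqEsubset cyclic_part_sub; apply/subsetP => x xY.
rewrite inE xY /= eqn_leq rk_mono ?subsetDl //=.
move: (xY); rewrite inE => /andP[xA /eqP rAx].
have := rk_cyclic_part A; rewrite -rAx => e.
have := rk_le_flat (A :\ x) (cyclic_part A :\ x).
suff -> : (A :\ x) :\: (cyclic_part A :\ x) = A :\: cyclic_part A by lia.
by apply/setP => z; rewrite !inE; case: (eqVneq z x) => [->|] //=; rewrite xA rAx eqxx.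
Qed.

Lemma indep_sub A B : A \subset B -> indep M B -> indep M A.
Proof.
move=> sAB /eqP iB; rewrite /indep eqn_leq rk_le_card /=.
have := rk_le_flat B A; rewrite iB (cardsD B A) (setIidPr sAB).
have := subset_leq_card sAB; lia.
Qed.

Lemma circuit_nocoloop C x : circuit M C -> x \in C -> r (C :\ x) = r C.
Proof.
move=> /minsetP[/= dC minC] xC; apply/eqP; rewrite eqn_leq rk_mono ?subsetDl //=.
have /eqP -> : indep M (C :\ x).
  apply: contraT => dCx; have /setP/(_ x) := minC _ dCx (subsetDl _ _).
  by rewrite !inE eqxx xC.
have : r C < #|C| by rewrite ltn_neqAle dC rk_le_card.
by rewrite (cardsD1 x C) xC.
Qed.

(** The circuit is a minimal subset [B] of [A] in which [x] is not a coloop. If [B :\ x] were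
    dependent, it would have a non-coloop [y], and [B :\ y] would contradict minimality. *)
Lemma nocoloop_circuit A x :
  x \in A -> r (A :\ x) = r A -> exists2 C, circuit M C & (C \subset A) && (x \in C).
Proof.
move=> xA rAx; pose P B := [&& B \subset A, x \in B & r (B :\ x) == r B].
have PA : P A by rewrite /P subxx xA rAx eqxx.
have [B /minsetP[/= /and3P[sB xB /eqP rB] minB] _] := minset_exists PA.
have iBx : indep M (B :\ x).
  apply: contraT => /negP dB; case: dB.
  rewrite /indep; have := rk_cyclic_part (B :\ x).
  suff -> : cyclic_part (B :\ x) = set0 by rewrite rk_set0 setD0 add0n => ->.
  apply/eqP; apply: contraT => /set0Pn[y]; rewrite !inE => /andP[/andP[yx yB] /eqP ry].
  have : P (B :\ y).
    rewrite /P (subset_trans _ sB) ?subsetDl //= !inE eq_sym yx xB /=.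
    have eD : B :\ y :\ x = B :\ x :\ y by apply/setP => z; rewrite !inE andbCA.
    rewrite eD ry rB eqn_leq [X in _ && X]rk_mono ?subsetDl // andbT.
    by rewrite -rB -ry -eD rk_mono ?subsetDl.
  by move/minB => /(_ (subsetDl _ _))/setP/(_ y); rewrite !inE eqxx yB.
have cB := cardsD1 x B; rewrite xB in cB.
exists B; last by rewrite sB.
apply/minsetP; split=> /= [|D dD sDB].
  by rewrite /indep -rB (eqP iBx) cB; apply/eqP; lia.
apply/eqP; rewrite eqEsubset sDB; apply: contraR dD => nBD.
have {nBD}[y yB yD] := subsetPn nBD.
have sDy : D \subset B :\ y by rewrite subsetD1 sDB.
apply: (indep_sub sDy); have [->//|yx] := eqVneq y x.
rewrite /indep eqn_leq rk_le_card /=.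
have rBy : r (B :\ x :\ y) <> r (B :\ y) -> r (B :\ x :\ y) < r (B :\ y).
  move/eqP; rewrite ltn_neqAle => ->; rewrite rk_mono //.
  by apply/subsetP => z; rewrite !inE => /and3P[-> _ ->].
have iBxy : r (B :\ x :\ y) = #|B :\ x :\ y|.
  by apply/eqP/(indep_sub _ iBx); rewrite subsetDl.
have cBy : #|B :\ y| = (#|B :\ x :\ y|).+1.
  rewrite (cardsD1 x (B :\ y)) !inE eq_sym yx xB /=; congr _.+1.
  by apply: eq_card => z; rewrite !inE andbCA.
rewrite cBy -iBxy; apply: rBy => rBy.
have : P (B :\ y).
  rewrite /P (subset_trans _ sB) ?subsetDl //= !inE eq_sym yx xB /=.
  have -> : B :\ y :\ x = B :\ x :\ y by apply/setP => z; rewrite !inE andbCA.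
  by rewrite rBy.
by move/minB => /(_ (subsetDl _ _))/setP/(_ y); rewrite !inE eqxx yB.
Qed.

Lemma cyclic_flatE A : cyclic_flat M A = flat M A && (cyclic_part A == A).
Proof.
rewrite /cyclic_flat; congr (_ && _); apply/existsP/eqP => [[P /andP[/forall_inP cP /eqP <-]]|cA].
  apply/eqP; rewrite eqEsubset cyclic_part_sub; apply/subsetP => x xP.
  have /bigcupP[C CP xC] := xP; rewrite inE xP /=; apply/eqP.
  apply: (rk_setD_subset xC); first exact: bigcup_sup.
  exact/circuit_nocoloop/xC/cP.
exists [set C | circuit M C & C \subset A]; apply/andP; split.
  by apply/forall_inP => C; rewrite inE => /andP[].
rewrite eqEsubset; apply/andP; split.
  by apply/bigcupsP => C; rewrite inE => /andP[].
apply/subsetP => x xA; move: (xA); rewrite -{1}cA inE => /andP[_ /eqP rA].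
have [C cC /andP[sC xC]] := nocoloop_circuit xA rA.
by apply/bigcupP; exists C; rewrite // inE cC.
Qed.

Lemma sub_cl A : A \subset cl M A.
Proof. by apply/subsetP => x xA; rewrite inE (setUidPr _) // sub1set. Qed.

Lemma rk_cl_sub A B : A \subset B -> B \subset cl M A -> r B = r A.
Proof.
have [k] := ubnP #|B :\: A|; elim: k B => // k IH B cB sAB sBcl.
have [|/subsetPn[x xB xA]] := boolP (B \subset A).
  by move=> sBA; congr r; apply/eqP; rewrite eqEsubset sBA.
have sAD : A \subset B :\ x by rewrite subsetD1 sAB.
have IHx : r (B :\ x) = r A.
  apply: IH => //; last by rewrite (subset_trans _ sBcl) ?subsetDl.
  rewrite -ltnS; apply: leq_trans cB; rewrite ltnS.
  rewrite (cardsD1 x (B :\: A)) !inE xA xB /= add1n ltnS subset_leq_card //.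
  by apply/subsetP => z; rewrite !inE => /and3P[-> -> ->].
have := rk_submodular M (x |: A) (B :\ x).
have -> : (x |: A) :|: B :\ x = B.
  apply/setP => z; rewrite !inE; case: (eqVneq z x) => [->|_] //=.
  by have := subsetP sAB z; case: (z \in A) => //= ->.
have := subsetP sBcl x xB; rewrite inE => /eqP ->.
have : r A <= r ((x |: A) :&: (B :\ x)).
  by rewrite rk_mono // subsetI sAD subsetUr.
have := rk_mono M sAB; rewrite IHx; lia.
Qed.

Lemma rk_cl A : r (cl M A) = r A.
Proof. exact: rk_cl_sub (sub_cl A) (subxx _). Qed.

Lemma clS A B : A \subset B -> cl M A \subset cl M B.
Proof.
move=> sAB; apply/subsetP => x; rewrite !inE => /eqP rA.
rewrite eqn_leq [X in _ && X]rk_mono ?subsetUr // andbT.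
have := rk_submodular M (x |: A) B.
have -> : x |: A :|: B = x |: B by rewrite -setUA (setUidPr sAB).
have : r A <= r ((x |: A) :&: B) by rewrite rk_mono // subsetI subsetUr.
rewrite rA; lia.
Qed.

Lemma flat_cl A : flat M (cl M A).
Proof.
rewrite /flat eqEsubset sub_cl andbT; apply/subsetP => x; rewrite !inE rk_cl => /eqP rx.
rewrite eqn_leq [X in _ && X]rk_mono ?subsetUr // andbT -rx rk_mono //.
by rewrite setUS // sub_cl.
Qed.

(* For cyclic flats Y and Z, cyclic_cl (Y :&: Z) is their meet.                *)
Definition cyclic_cl A := cl M (cyclic_part A).

Lemma cyclic_flat_cyclic_cl A : cyclic_flat M (cyclic_cl A).
Proof.
rewrite cyclic_flatE flat_cl eqEsubset cyclic_part_sub; apply/subsetP => x xcl.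
rewrite inE xcl /=; have [xY|xY] := boolP (x \in cyclic_part A).
  apply/eqP/(rk_setD_subset xY (sub_cl _)).
  by move: xY; rewrite -{1}cyclic_part_id inE => /andP[_ /eqP].
rewrite eqn_leq rk_mono ?subsetDl //= [leqLHS]rk_cl rk_mono //.
by rewrite subsetD1 sub_cl.
Qed.

Lemma cyclic_clS A B : A \subset B -> cyclic_cl A \subset cyclic_cl B.
Proof. by move=> sAB; apply/clS/cyclic_partS. Qed.

Lemma cyclic_cl_id A : cyclic_flat M A -> cyclic_cl A = A.
Proof. by rewrite cyclic_flatE /cyclic_cl => /andP[/eqP fA /eqP ->]. Qed.

Lemma cyclic_cl_sub A B : cyclic_flat M B -> A \subset B -> cyclic_cl A \subset B.
Proof. by move=> cB /cyclic_clS; rewrite (cyclic_cl_id cB). Qed.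

(** Dropping a coloop lowers the rank by one and adds at most one element to [S :\: A]; closure then
    keeps the rank and can only shrink the difference. *)
Lemma rk_cyclic_cl A S : r (cyclic_cl A) + #|S :\: cyclic_cl A| <= r A + #|S :\: A|.
Proof.
rewrite rk_cl -(rk_cyclic_part A) -addnA leq_add2l.
have -> : #|A :\: cyclic_part A| + #|S :\: A| = #|(A :\: cyclic_part A) :|: (S :\: A)|.
  rewrite cardsU; have -> : (A :\: cyclic_part A) :&: (S :\: A) = set0.
    by apply/setP => z; rewrite !inE; case: (z \in A); rewrite ?andbF.
  by rewrite cards0 subn0.
apply/subset_leq_card/subsetP => z; rewrite ![in z \in _ :\: _]in_setD in_setU !in_setD.
move=> /andP[zc ->]; rewrite andbT.
by have := contra (subsetP (sub_cl (cyclic_part A)) z) zc; case: (z \in A) => ->.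
Qed.

(** Together with [rk_le_flat], this shows that the minimum of [r(G) + |A \ G|] is attained at the
    cyclic flat [cyclic_cl A]. *)
Lemma rk_cyclic_clE A : r (cyclic_cl A) + #|A :\: cyclic_cl A| = r A.
Proof.
apply/eqP; rewrite eqn_leq rk_le_flat andbT.
by have := rk_cyclic_cl A A; rewrite setDv cards0 addn0.
Qed.

(** Every element of [A] outside [Z] raises the rank over [Z] by one, so
    [r(Z) + |(S & Y) \ Z| <= r(Y | Z)]. Submodularity for [Y] and [Z] then bounds the value at
    [Y :&: Z], and [rk_cyclic_cl] passes to the meet. This is what makes [Y] redundant. *)
Lemma rk_meet_cyclic_cl S A Y : S \subset A ->
  let X := cyclic_cl (Y :&: cyclic_cl A) in r X + #|S :\: X| <= r Y + #|S :\: Y|.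
Proof.
move=> sSA /=; set Z := cyclic_cl A; apply: leq_trans (rk_cyclic_cl _ _) _.
have : r Z + #|(S :&: Y) :\: Z| <= r (Y :|: Z).
  have eA := rk_cyclic_clE A; rewrite -/Z in eA.
  have h1 := rk_le_flat A (Z :|: (S :&: Y)).
  have h2 : r (Z :|: (S :&: Y)) <= r (Y :|: Z).
    by rewrite rk_mono // setUC setSU // subsetIr.
  have h3 : #|A :\: Z| = #|(S :&: Y) :\: Z| + #|A :\: (Z :|: (S :&: Y))|.
    rewrite -(cardsID (S :&: Y)); congr (_ + _); last by rewrite setDDl.
    apply: eq_card => z; rewrite !inE; have := subsetP sSA z.
    by case: (z \in S); rewrite ?andbF //= => -> //; rewrite andbT andbC.
  lia.
have := rk_submodular M Y Z.
have -> : #|S :\: (Y :&: Z)| = #|S :\: Y| + #|(S :&: Y) :\: Z|.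
  rewrite -(cardsID Y) addnC; congr (_ + _); apply: eq_card => z; rewrite !inE.
    by case: (z \in Y).
  by case: (z \in Y); rewrite ?andbF ?andbT.
lia.
Qed.

Lemma cyclic_flatT : (forall x, ~~ is_coloop M x) -> cyclic_flat M setT.
Proof.
move=> ncl; rewrite cyclic_flatE; apply/andP; split.
  by rewrite /flat -subTset sub_cl.
rewrite -subTset; apply/subsetP => x _; rewrite !inE /=.
have /forallPn[B] := ncl x; rewrite negb_imply => /andP[/maxsetP[/= iB maxB] xB].
suff rB : r B = r setT.
  by rewrite eqn_leq rk_mono ?subsetDl //= -rB rk_mono // subsetD1 subsetT.
rewrite -(@rk_cl_sub B setT) ?subsetT //; apply/subsetP => y _; rewrite inE.
have [yB|yB] := boolP (y \in B); first by rewrite (setUidPr _) // sub1set.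
rewrite eqn_leq [X in _ && X]rk_mono ?subsetUr // andbT leqNgt.
apply/negP => lt; have : indep M (y |: B).
  rewrite /indep eqn_leq rk_le_card cardsU1 yB add1n.
  by move: lt; rewrite (eqP iB) => ->.
by move/maxB => /(_ (subsetUr _ _)) e; rewrite -e setU11 in yB.
Qed.

End MatroidTheory.

(** * Rank functions of nested matroids *)

Section ChainRank.
Variables (E T : finType) (phi : T -> {set E}) (rho : T -> nat).

(* The empty chain gives the free matroid.                                     *)
Definition chain_rank (C : {set T}) (S : {set E}) : nat :=
  \big[Order.min/#|S|]_(G in C) (rho G + #|S :\: phi G|).

Lemma leq_chain_rank C S k :
  k <= chain_rank C S = (k <= #|S|) && [forall G in C, k <= rho G + #|S :\: phi G|].
Proof.
rewrite -leEnat; apply/bigmin_geP/andP => [[kS kf]|[kS /forall_inP kf]] //.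
by split=> //; apply/forall_inP.
Qed.

Lemma eq_chain_rank C D S : (forall k, k <= chain_rank C S = (k <= chain_rank D S)) ->
  chain_rank C S = chain_rank D S.
Proof. by move=> e; apply/eqP; rewrite eqn_leq -e leqnn e leqnn. Qed.

Lemma chain_rank_redundant (C : {set T}) x y S :
  x \in C -> rho x + #|S :\: phi x| <= rho y + #|S :\: phi y| ->
  chain_rank (y |: C) S = chain_rank C S.
Proof.
move=> xC lxy; apply: eq_chain_rank => k; rewrite !leq_chain_rank; congr (_ && _).
apply/forall_inP/forall_inP => kf G; first by move=> GC; rewrite kf // setU1r.
by move=> /setU1P[->|]; [apply: leq_trans (kf x xC) lxy|apply: kf].
Qed.

End ChainRank.

(** * The rank sequence of one permutation as a sum over chains *)

Section ChainFormula.
Variables (E T : finType) (M : matroid E) (le : rel T) (phi : T -> cyclic_flats M).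
Hypothesis phi_iso : order_iso le (@cyclic_flats_le E M) phi.
Let fl (y : T) : {set E} := val (phi y).
Let crk := chain_rank fl (fun y => rk M (fl y)).

Lemma iso_refl : reflexive le.
Proof. by move=> x; rewrite -phi_iso.2 /cyclic_flats_le. Qed.

Lemma iso_trans : transitive le.
Proof. by move=> y x z; rewrite -!phi_iso.2; apply: subset_trans. Qed.

Lemma iso_anti : antisymmetric le.
Proof.
move=> x y; rewrite -!phi_iso.2 => h; apply: (bij_inj phi_iso.1); apply: val_inj.
by apply/eqP; rewrite eqEsubset.
Qed.

Let flat_of A : {y | fl y = cyclic_cl M A}.
Proof.
pose X : cyclic_flats M := exist (fun Y => cyclic_flat M Y) _ (cyclic_flat_cyclic_cl M A).
have [y yX] : {y | val (phi y) == val X}.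
  apply: sigW; have [psi _ psiK] := phi_iso.1.
  by exists (psi X); rewrite psiK.
by exists y; apply/eqP.
Qed.

(** The witness consists of the flats [cyclic_cl M (S i)]. Once they are in every set, all chain
    ranks of the [S i] are the true ranks, so [V] has become constant and [chainsum_const]
    applies. *)
Lemma chainsum_chain_rank (N : nat) (S : nat -> {set E}) (V : {set T} -> int) :
  {homo S : i j / i <= j >-> i \subset j} ->
  (forall C D, (forall i, i <= N -> crk C (S i) = crk D (S i)) -> V C = V D) ->
  exists2 C, chainsum le V = V C & forall i, i <= N -> crk C (S i) = rk M (S i).
Proof.
move=> monoS VP.
pose Fl j := sval (flat_of (S j)).
have FlE j : fl (Fl j) = cyclic_cl M (S j) by rewrite /Fl; case: flat_of.
pose D k := [set x in [seq Fl i | i <- iota k (N.+1 - k)]].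
have FlD k j : k <= j <= N -> Fl j \in D k.
  by move=> kjN; rewrite inE map_f // mem_iota; lia.
have DS k : k <= N -> D k = Fl k |: D k.+1.
  move=> kN; rewrite /D; have -> : N.+1 - k = (N.+1 - k.+1).+1 by lia.
  by apply/setP => x; rewrite !inE.
(* The cyclic flats of the sets S i can be added to C from i = N downwards:    *)
(* meeting y with the flat of S j makes y redundant for S i with i <= j, and   *)
(* the flats already added make it redundant for the larger i.                 *)
have step k : k <= N.+1 ->
    chainsum le V = chainsum le (fun C => V (D (N.+1 - k) :|: C)).
  elim: k => [_|k IH kN].
    rewrite subn0; have -> : D N.+1 = set0 by apply/setP => x; rewrite /D subnn !inE.
    by apply: eq_bigr => A _; apply: eq_altsum => C _; rewrite set0U.
  rewrite IH; last by lia.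
  set j := N.+1 - k.+1; have jN : j <= N by rewrite /j; lia.
  have -> : N.+1 - k = j.+1 by rewrite /j; lia.
  pose m y := sval (flat_of (fl y :&: cyclic_cl M (S j))).
  have mE y : fl (m y) = cyclic_cl M (fl y :&: cyclic_cl M (S j)).
    by rewrite /m; case: flat_of.
  have leE x y : le x y = (fl x \subset fl y) by rewrite -phi_iso.2.
  have cfl y : cyclic_flat M (fl y) := valP (phi y).
  rewrite (@chainsumU1 T le iso_refl iso_trans (Fl j) m).
  - apply: eq_bigr => A _; apply: eq_altsum => C _.
    by rewrite /= (DS j) // setUCA setUA.
  - by move=> y; rewrite leE mE cyclic_cl_sub ?subsetIl.
  - by move=> y; rewrite leE mE FlE cyclic_cl_sub ?subsetIr ?cyclic_flat_cyclic_cl.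
  - move=> z y; rewrite !leE mE FlE => zy zF.
    by rewrite -(cyclic_cl_id (cfl z)) cyclic_clS // subsetI zy.
  move=> y C _; apply: VP => i iN.
  rewrite setUCA; have [lij|lji] := leqP i j.
    apply: (@chain_rank_redundant _ _ _ _ _ (m y)).
      by rewrite !inE eqxx orbT.
    by rewrite mE; apply: rk_meet_cyclic_cl; apply: monoS.
  apply: (@chain_rank_redundant _ _ _ _ _ (Fl i)).
    by rewrite inE FlD // lji.
  by rewrite FlE rk_cyclic_clE rk_le_flat.
have crkE (C : {set T}) i : Fl i \in C -> crk C (S i) = rk M (S i).
  move=> FC; apply/eqP; rewrite eqn_leq; apply/andP; split.
    have := leqnn (crk C (S i)); rewrite {2}/crk leq_chain_rank => /andP[_ /forall_inP].
    by move=> /(_ (Fl i) FC); rewrite FlE rk_cyclic_clE.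
  rewrite /crk leq_chain_rank rk_le_card; apply/forall_inP => G _.
  exact: rk_le_flat.
exists (D 0); last by move=> i iN; rewrite crkE // FlD.
rewrite (step N.+1) // subnn -[RHS](chainsum_const le).
apply: eq_bigr => A _; apply: eq_altsum => C _; apply: VP => i iN.
by rewrite !crkE ?in_setU ?FlD.
Qed.

End ChainFormula.

(** * Nested families with the same sizes and ranks *)

(** The counts of sublevel sets determine the multiset of values. Sorting both sets by value and
    matching equal positions gives the bijection. *)
Lemma bijection_of_level (E E' : finType) (l : E -> nat) (l' : E' -> nat) :
  #|E| = #|E'| ->
  (forall k, #|[set x | l x <= k]| = #|[set x | l' x <= k]|) ->
  exists2 f : E -> E', bijective f & l' \o f =1 l.
Proof.
move=> cE cl.
have perm_l : perm_eq (map l (enum E)) (map l' (enum E')).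
  have count_le (X : finType) (h : X -> nat) k :
      count (fun v => v <= k) (map h (enum X)) = #|[set x | h x <= k]|.
    by rewrite count_map -size_filter cardsE cardE /enum_mem -enumT -filter_predI;
       congr size; apply: eq_filter => x; rewrite /= andbT.
  apply/allP => k _ /=; apply/eqP.
  have split_le (s : seq nat) : count (fun v => v <= k) s =
      count_mem k s + (if k is k'.+1 then count (fun v => v <= k') s else 0).
    elim: s => [|v s IH] /=; first by case: (k).
    rewrite IH; case: k {IH} => [|k] /=; first by rewrite leqn0 !addn0.
    by rewrite (leq_eqVlt v) ltnS; case: eqVneq => [->|_] /=; rewrite ?ltnn; lia.
  have e1 := split_le (map l (enum E)); have e2 := split_le (map l' (enum E')).
  rewrite !count_le cl in e1; rewrite !count_le in e2.
  case: k e1 e2 {split_le} => [|k]; rewrite ?count_le ?cl => e1 e2.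
    by apply: (@addIn 0); rewrite -e1 -e2.
  by apply: (@addIn #|[set x | l' x <= k]|); rewrite -e1 -e2.
pose ss := sort (relpre l leq) (enum E); pose tt := sort (relpre l' leq) (enum E').
have map_st : map l ss = map l' tt.
  by rewrite /ss /tt -!sort_map;
     apply/perm_sortP => //; [exact: leq_total|exact: leq_trans|exact: anti_leq].
have ss_all x : x \in ss by rewrite mem_sort mem_enum.
have ss_u : uniq ss by rewrite sort_uniq enum_uniq.
have tt_u : uniq tt by rewrite sort_uniq enum_uniq.
have sz : size ss = size tt by rewrite !size_sort -!cardT.
(* [nth] takes a default element of [E'], so the empty case is treated apart. *)
case: (pickP (fun _ : E' => true)) => [y0 _|E'0]; last first.
  have E0 : #|E| = 0 by rewrite cE; apply: eq_card0.
  have noE (x : E) : False by have := card0_eq E0 x; rewrite inE.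
  exists (fun x => False_rect _ (noE x)) => [|x]; last by case: (noE x).
  by apply: inj_card_bij => [x|]; [case: (noE x)|rewrite cE].
exists (fun x => nth y0 tt (index x ss)) => [|x /=].
  apply: inj_card_bij; last by rewrite cE.
  move=> x y /eqP; rewrite nth_uniq -?sz ?index_mem // => /eqP e.
  by rewrite -(nth_index x (ss_all x)) e nth_index.
have lt : index x ss < size tt by rewrite -sz index_mem.
by rewrite -(nth_map _ 0 l') // -map_st (nth_map x) ?sz // nth_index.
Qed.

Section Level.
Variables (E T : finType) (phi : T -> {set E}) (C : {set T}).
Hypothesis chC : {in C &, forall G H, (phi G \subset phi H) || (phi H \subset phi G)}.

(* The default value exceeds every cardinal, so that the sublevel sets of the  *)
(* level are members of the chain, the empty set or the whole set.             *)
Definition level (x : E) : nat :=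
  \big[Order.min/#|E|.+1]_(G in C | x \in phi G) #|phi G|.

Lemma level_leP x k :
  reflect (#|E| < k \/ exists2 G, G \in C & (x \in phi G) && (#|phi G| <= k)) (level x <= k).
Proof.
rewrite -(leEnat) /level; apply: (iffP idP) => [|[kE|[G GC /andP[xG Gk]]]].
- rewrite leEnat leqNgt => lk; have [/= kE|kE] := ltnP #|E| k; [by left|right].
  apply/exists_inP; apply: contraNT lk; rewrite negb_exists => /forallP no.
  rewrite -leEnat; apply/bigmin_geP; split; first by rewrite leEnat ltnS.
  move=> G /andP[GC xG]; rewrite leEnat ltnNge; apply/negP => Gk.
  by have := no G; rewrite GC xG Gk.
- by apply: le_trans (bigmin_le_id _ _ _ _) _; rewrite leEnat.
- by apply: (@bigmin_inf _ _ _ _ G); rewrite ?GC.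
Qed.

(** A member no larger than [phi G] is contained in it by nestedness, so [phi G] is recovered as a
    sublevel set. *)
Lemma level_chain G x : G \in C -> (level x <= #|phi G|) = (x \in phi G).
Proof.
move=> GC; apply/level_leP/idP => [[|[H HC /andP[xH HG]]]|xG].
- by rewrite ltnNge max_card.
- have /orP[sHG|sGH] := chC HC GC; first exact: (subsetP sHG).
  suff -> : phi G = phi H by [].
  by apply/eqP; rewrite eqEcard sGH.
- by right; exists G; rewrite ?xG /=.
Qed.

(** For [k] up to [#|E|], the sublevel set is the largest member of size at most [k], or empty; its
    size thus depends only on the sizes in the chain. *)
Lemma card_level k : #|[set x | level x <= k]| =
  if #|E| < k then #|E| else \max_(G in C | #|phi G| <= k) #|phi G|.
Proof.
case: ltnP => kE.
  by rewrite -cardsT; apply: eq_card => x; rewrite !inE; apply/level_leP; left.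
pose P G := (G \in C) && (#|phi G| <= k).
have [H PH|no] := pickP P; last first.
  rewrite big_pred0 //; apply: eq_card0 => x; rewrite inE.
  apply/level_leP => -[|[G GC /andP[_ Gk]]]; first by rewrite ltnNge kE.
  by have := no G; rewrite /P GC Gk.
have [G /andP[GC Gk] Gmax] := arg_maxnP (fun G => #|phi G|) PH.
have -> : \max_(G in C | #|phi G| <= k) #|phi G| = #|phi G|.
  apply/eqP; rewrite eqn_leq; apply/andP; split.
    by apply/bigmax_leqP => H' PH'; apply: Gmax.
  by apply: (bigop.bigmax_sup G); rewrite ?GC.
apply: eq_card => x; rewrite inE; apply/level_leP/idP => [[|[H' HC /andP[xH HG]]]|xG].
- by rewrite ltnNge kE.
- have := Gmax H'; rewrite /P HC HG => /(_ isT) cHG.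
  have /orP[sHG|sGH] := chC HC GC; first exact: (subsetP sHG).
  suff -> : phi G = phi H' by [].
  by apply/eqP; rewrite eqEcard sGH.
- by right; exists G; rewrite ?xG.
Qed.

End Level.

Definition label (E T : finType) (phi : T -> {set E}) (rho : T -> nat) (G : T) :=
  (#|phi G|, rho G).

Definition same_labels (T T' : finType) (w : T -> nat * nat) (w' : T' -> nat * nat)
    (C : {set T}) (D : {set T'}) :=
  (forall G, G \in C -> exists2 H, H \in D & w' H = w G) /\
  (forall H, H \in D -> exists2 G, G \in C & w G = w' H).

Definition chain_seq (E T : finType) (phi : T -> {set E}) (rho : T -> nat)
    (C : {set T}) (n : nat) (e : seq E) : seq nat :=
  mkseq (fun i => chain_rank phi rho C [set x in take i.+1 e]
                  - chain_rank phi rho C [set x in take i e]) n.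

Definition chain_count (E T : finType) (phi : T -> {set E}) (rho : T -> nat)
    (n : nat) (v : seq nat) (C : {set T}) : nat :=
  #|[set e : n.-tuple E | uniq e && (chain_seq phi rho C n e == v)]|.

Section Transport.
Variables (E E' T T' : finType) (phi : T -> {set E}) (phi' : T' -> {set E'}).
Variables (rho : T -> nat) (rho' : T' -> nat) (C : {set T}) (C' : {set T'}).
Hypothesis chC : {in C &, forall G H, (phi G \subset phi H) || (phi H \subset phi G)}.
Hypothesis chC' : {in C' &, forall G H, (phi' G \subset phi' H) || (phi' H \subset phi' G)}.
Hypothesis labels : same_labels (label phi rho) (label phi' rho') C C'.
Hypothesis cardE : #|E| = #|E'|.

(** Equal labels give the two [level] functions sublevel sets of equal sizes; a bijection matching
    levels then carries each member to those of its size, by [level_chain]. *)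
Lemma chain_bijection : exists2 f : E -> E', bijective f &
  {in C & C', forall G H, #|phi G| = #|phi' H| -> phi' H = f @: phi G}.
Proof.
have [l l'] := labels.
have [|f bij_f lf] := @bijection_of_level _ _ (level phi C) (level phi' C') cardE.
  move=> k; rewrite !card_level // cardE; case: ifP => // _; apply/eqP.
  rewrite eqn_leq; apply/andP; split; apply/bigmax_leqP => G /andP[GC Gk].
    have [H HC' [wH _]] := l G GC.
    by rewrite -wH (bigop.bigmax_sup H) // HC' wH.
  have [H HC' [wH _]] := l' G GC.
  by rewrite -wH (bigop.bigmax_sup H) // HC' wH.
exists f => // G H GC HC' e; apply/setP => y; have [g fK gK] := bij_f.
rewrite -(gK y) mem_imset; last exact: bij_inj.
by rewrite -(level_chain chC' _ HC') // -e -(level_chain chC _ GC) -lf.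
Qed.

Lemma chain_rank_transport (f : E -> E') (S : {set E}) : injective f ->
  {in C & C', forall G H, #|phi G| = #|phi' H| -> phi' H = f @: phi G} ->
  chain_rank phi' rho' C' (f @: S) = chain_rank phi rho C S.
Proof.
move=> inj_f fC; have [l l'] := labels.
have fD G H : G \in C -> H \in C' -> label phi' rho' H = label phi rho G ->
    rho' H + #|(f @: S) :\: phi' H| = rho G + #|S :\: phi G|.
  move=> GC HC [eH ->]; rewrite (fC G H) // -(card_imset (S :\: _) inj_f).
  congr (_ + _); apply: eq_card => y; rewrite inE; apply/andP/imsetP => [[yG /imsetP[x xS ey]]|[x]].
    by exists x; rewrite // inE xS andbT; apply: contra yG => xG; rewrite ey imset_f.
  by rewrite inE => /andP[xG xS] ->; rewrite !mem_imset.
suff le_iff k : k <= chain_rank phi' rho' C' (f @: S) = (k <= chain_rank phi rho C S).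
  by apply/eqP; rewrite eqn_leq -le_iff leqnn le_iff leqnn.
rewrite !leq_chain_rank (card_imset S inj_f); congr (_ && _).
apply/forall_inP/forall_inP => h G GC.
  by have [H HC wH] := l G GC; rewrite -(fD G H) // h.
by have [H HC wH] := l' G GC; rewrite (fD H G) // h.
Qed.

Lemma chain_count_transport n v :
  chain_count phi rho n v C = chain_count phi' rho' n v C'.
Proof.
have [f bij_f fC] := chain_bijection; have inj_f := bij_inj bij_f.
have seqE e : chain_seq phi' rho' C' n (map f e) = chain_seq phi rho C n e.
  apply: eq_mkseq => i; rewrite -!map_take.
  have setE s : [set x in map f s] = f @: [set x in s].
    by apply/setP => y; rewrite inE; apply/mapP/imsetP => -[x]; rewrite ?inE => xs ->;
       exists x; rewrite ?inE.
  by rewrite !setE !chain_rank_transport.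
have inj_map : injective (fun e : n.-tuple E => [tuple of map f e]).
  by move=> e1 e2 /(congr1 val) /= /(inj_map inj_f) /val_inj.
rewrite /chain_count -(card_imset _ inj_map); apply: eq_card => e'.
rewrite inE; apply/imsetP/idP => [[e]|].
  by rewrite inE => /andP[ue /eqP ve] ->; rewrite /= map_inj_uniq // ue seqE ve eqxx.
have [g fK gK] := bij_f.
have -> : e' = [tuple of map f [tuple of map g e']].
  by apply: val_inj; rewrite /= mapK.
rewrite /= seqE map_inj_uniq // => /andP[ue ve].
by exists [tuple of map g e']; rewrite ?inE ?ue.
Qed.

End Transport.

(** * Counting permutations with a given rank sequence *)

(** For a fixed permutation, the indicator of [v] depends only on the chain ranks of initial
    segments, so [chainsum_chain_rank] applies. Linearity of [altsum] then allows the sum over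
    permutations to be moved inside. *)
Lemma rank_seq_count (E T : finType) (M : matroid E) (le : rel T)
    (phi : T -> cyclic_flats M) (n : nat) (v : seq nat) :
  order_iso le (@cyclic_flats_le E M) phi ->
  (#|[set e : n.-tuple E | uniq e && (rank_seq M e == v)]|%:Z =
   chainsum le (fun C =>
     (chain_count (fun y => val (phi y)) (fun y => rk M (val (phi y))) n v C)%:Z))%R.
Proof.
move=> phi_iso; pose fl y := val (phi y); pose rho y := rk M (fl y).
pose V (e : n.-tuple E) (C : {set T}) : int := (((chain_seq fl rho C n e == v) : nat)%:Z)%R.
have cardE' (P : pred (n.-tuple E)) :
    (#|[set e : n.-tuple E | uniq e && P e]|%:Z =
     \sum_(e : n.-tuple E | uniq e) (P e : nat)%:Z)%R.
  rewrite -sum1_card (eq_bigl (fun e : n.-tuple E => uniq e && P e)) => [|e]; last by rewrite inE.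
  by rewrite big_mkcondr -(big_morph Posz PoszD (erefl _));
     congr Posz; apply: eq_bigr => e _; case: (P e).
rewrite cardE' /chainsum.
transitivity (\sum_(e : n.-tuple E | uniq e) chainsum le (V e))%R.
  apply: eq_bigr => e _.
  have [C -> rkC] : exists2 C, chainsum le (V e) = V e C &
      forall i, i <= n -> chain_rank fl rho C [set x in take i e] = rk M [set x in take i e].
    apply: (chainsum_chain_rank phi_iso) => [i j ij|C D CD].
      apply/subsetP => x; rewrite !inE => xi.
      by rewrite -(subnKC ij) takeD mem_cat xi.
    rewrite /V; suff -> : chain_seq fl rho C n e = chain_seq fl rho D n e by [].
    apply/eq_in_map => i; rewrite mem_iota => /andP[_ ilt].
    by rewrite !CD // ltnW.
  rewrite /V; suff -> : rank_seq M e = chain_seq fl rho C n e by [].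
  rewrite /rank_seq size_tuple; apply/eq_in_map => i; rewrite mem_iota => /andP[_ ilt].
  by rewrite !rkC // ltnW.
rewrite exchange_big; apply: eq_bigr => A _ /=; rewrite /altsum exchange_big.
by apply: eq_bigr => C _; rewrite -mulr_sumr cardE'.
Qed.

(** * The order on a lattice with inserted lattices *)

Section InsertionOrder.
Variables (d : Order.disp_t) (L : finTBLatticeType d) (n : nat).
Variables (dK : 'I_n -> Order.disp_t) (K : forall i, finTBLatticeType (dK i)).
Local Notation T := (insertion L K).

Definition new (i : 'I_n) (z : inner K i) : T := inr (existT (fun j => inner K j : Type) i z).

Definition insertion_leb (p : 'I_n -> L) : rel T := fun u v =>
  match u, v with
  | inl x, inl y => (x <= y)%O
  | inl x, inr z => (x <= p (tag z))%O
  | inr _, inl y => y == \top%O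
  | inr z, inr z' => (tag z == tag z') && (val (tagged z) <= val (tagged_as z z'))%O
  end.

Variable p : 'I_n -> L.
Hypothesis anti_p : antisymmetric (insertion_le K p).

Lemma relabel_new i (z : inner K i) : relabel p (val z) = new z.
Proof. by rewrite /relabel valK. Qed.

Lemma relabel_top i : relabel p (\top%O : K i) = old K \top%O.
Proof. by rewrite /relabel insubN ?ltxx ?andbF // eqxx. Qed.

(** The element [z] rules out a one-element [K i], whose bottom is sent to the top of [L]. *)
Lemma relabel_bot i (z : inner K i) : relabel p (\bot%O : K i) = old K (p i).
Proof.
rewrite /relabel insubN ?ltxx //; case: eqVneq => // bt.
by have /andP[lt1 lt2] := valP z; have := lt_trans lt1 lt2; rewrite -bt ltxx.
Qed.

Let le_old x y : (x <= y)%O -> insertion_le K p (old K x) (old K y).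
Proof.
move=> xy; apply: connect1; apply/orP; left; apply/existsP; exists x.
by apply/existsP; exists y; rewrite !eqxx.
Qed.

Let le_relabel i (x y : K i) : (x <= y)%O -> insertion_le K p (relabel p x) (relabel p y).
Proof.
move=> xy; apply: connect1; apply/orP; right; apply/existsP; exists i.
by apply/existsP; exists x; apply/existsP; exists y; rewrite !eqxx.
Qed.

Let le_old_new i (z : inner K i) : insertion_le K p (old K (p i)) (new z).
Proof. by rewrite -relabel_new -(relabel_bot z) le_relabel ?le0x. Qed.

Let le_new_top i (z : inner K i) : insertion_le K p (new z) (old K \top%O).
Proof. by rewrite -relabel_new -(relabel_top i) le_relabel ?lex1. Qed.

(** Otherwise [new z] would lie both above and below the top of [L], against antisymmetry. *)
Lemma insertion_nontop i (z : inner K i) : p i != \top%O.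
Proof.
apply/eqP => pt; have := le_old_new z; rewrite pt => le1.
by have := anti_p (introT andP (conj le1 (le_new_top z))).
Qed.

Let leb_refl : reflexive (insertion_leb p).
Proof. by case=> [x|[i z]] /=; rewrite ?lexx // eqxx tagged_asE lexx. Qed.

Let leb_trans : transitive (insertion_leb p).
Proof.
move=> v u w; case: v => [y|[j z']]; case: u => [x|[i z]]; case: w => [t|[k z'']] //=.
- exact: le_trans.
- exact: le_trans.
- by move=> /eqP-> ; rewrite le1x.
- by move=> /eqP->; rewrite le1x (negPf (insertion_nontop z'')).
- by move=> _ /eqP->; rewrite lex1.
- by move=> xj /andP[/eqP ejk _]; rewrite -ejk.
- move=> /andP[/eqP e]; case: _ / e in z' *; rewrite tagged_asE => le1.
  move=> /andP[/eqP e]; case: _ / e in z'' *; rewrite !tagged_asE eqxx /=.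
  exact: le_trans.
Qed.

Let leb_relabel i (x y : K i) : (x <= y)%O -> insertion_leb p (relabel p x) (relabel p y).
Proof.
have cases (x' : K i) : (exists z : inner K i, x' = val z) \/ x' = \top%O
    \/ [/\ x' = \bot%O & relabel p x' = old K (p i)].
  have [x0|] := boolP (\bot < x' < \top)%O; first by left; exists (exist _ x' x0).
  move=> x'n; have [xt|xt] := eqVneq x' \top%O; first by right; left.
  right; right; move: (x'n); rewrite lt0x ltx1 xt andbT negbK => /eqP xb.
  split=> //; rewrite /relabel insubN ?(negPf xt) //.
move=> xy; have [[z ex]|[ex|[ex rx]]] := cases x.
- rewrite ex relabel_new; have [[z' ey]|[ey|[ey ry]]] := cases y.
  + by rewrite ey relabel_new /= eqxx tagged_asE -ex -ey.
  + by rewrite ey relabel_top /=.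
  + by move: xy (valP z); rewrite ey lex0 -ex => /eqP ->; rewrite ltxx.
- by move: xy; rewrite ex le1x => /eqP ->; apply: leb_refl.
- rewrite rx; have [[z' ey]|[ey|[ey ry]]] := cases y.
  + by rewrite ey relabel_new /= lexx.
  + by rewrite ey relabel_top /= lex1.
  + by rewrite ry /= lexx.
Qed.

(** [insertion_leb] is reflexive, transitive and contains [union_le]. Conversely each of its cases
    is a path of at most two steps, an old element reaching a new one through the attaching
    point. *)
Lemma insertion_leE : insertion_le K p =2 insertion_leb p.
Proof.
have sub_union u v : union_le p u v -> insertion_leb p u v.
  case/orP => /existsP[i /existsP[x]].
    by case/and3P => /eqP-> /eqP->.
  by case/existsP => y /and3P[/eqP-> /eqP->]; apply: leb_relabel.
move=> u v; apply/idP/idP.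
  case/connectP => q; elim: q u => [|u' q IH] u /=; first by move=> _ ->; apply: leb_refl.
  by case/andP => /sub_union uu' /IH h /h; apply: leb_trans.
case: u => [x|[i z]]; case: v => [y|[j z']] /=.
- exact: le_old.
- by move=> /le_old xp; apply: connect_trans xp (le_old_new z').
- by move=> /eqP->; apply: le_new_top.
- move=> /andP[/eqP e]; case: _ / e in z' *; rewrite tagged_asE => le1.
  by have := le_relabel le1; rewrite !relabel_new.
Qed.

End InsertionOrder.

(** * Moving chains between the two lattices *)

Section ChainMap.
Variables (d : Order.disp_t) (L : finTBLatticeType d) (n : nat).
Variables (dK : 'I_n -> Order.disp_t) (K : forall i, finTBLatticeType (dK i)).
Local Notation T := (insertion L K).
Variables (J : Type) (a : J -> L) (theta : J -> J -> L -> L).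
Hypothesis theta_le : forall j k x, (x <= a j -> theta j k x <= a k)%O.
Hypothesis thetaK : forall j k x, (x <= a j)%O -> theta k j (theta j k x) = x.
Hypothesis theta_mono : forall j k x y, (x <= a j -> y <= a j -> x <= y ->
  theta j k x <= theta j k y)%O.
Variables (W : Type) (w : T -> W).
Hypothesis w_theta : forall j k x, (x <= a j)%O -> w (old K (theta j k x)) = w (old K x).

Definition lift_theta (j k : J) (u : T) : T :=
  if u is inl x then old K (if (x <= a j)%O then theta j k x else x) else u.

Definition has_new (C : {set T}) (i : 'I_n) : bool := [exists z : inner K i, new L z \in C].

(** A chain has new elements from at most one [K i], so for chains the choice made by [pick] is
    forced. *)
Definition chain_map (s t : 'I_n -> J) (C : {set T}) : {set T} :=
  if [pick i | has_new C i] is Some i then lift_theta (s i) (t i) @: C else C.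

Variables s t : 'I_n -> J.
Hypothesis anti_s : antisymmetric (insertion_le K (a \o s)).
Hypothesis anti_t : antisymmetric (insertion_le K (a \o t)).

(** If [C] has a new element of [K i], its other elements are new in [K i], equal to the top, or
    below [a (s i)]. Only the last kind moves, by an order-preserving [theta] with inverse
    [theta (t i) (s i)]; the new elements stay, so the inverse map finds the same [i]. *)
Lemma chain_mapP (C : {set T}) : is_chain (insertion_le K (a \o s)) C ->
  [/\ is_chain (insertion_le K (a \o t)) (chain_map s t C),
      chain_map t s (chain_map s t C) = C &
      exists f : T -> T, [/\ chain_map s t C = f @: C, {in C &, injective f}
        & {in C, forall u, w (f u) = w u}]].
Proof.
move=> /is_chainP chC; rewrite /chain_map.
case pickC: [pick i | has_new C i] => [i|]; last first.
  have noC i : has_new C i = false by move: pickC; case: pickP.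
  split=> //; last by exists id; split; rewrite ?imset_id.
    apply/is_chainP => u v uC vC; have := chC u v uC vC.
    rewrite !insertion_leE //.
    have isold u' : u' \in C -> exists x, u' = old K x.
      case: u' => [x|[i z]] u'C; first by exists x.
      by have /existsP[] := noC i; exists z.
    by have [[x ->] [y ->]] := (isold u uC, isold v vC).
  by rewrite pickC.
have [z zC] : exists z : inner K i, new L z \in C.
  by move: pickC; case: pickP => // i' /existsP[z zC] [<-]; exists z.
pose f := lift_theta (s i) (t i); pose g := lift_theta (t i) (s i).
(* The top lies in neither interval, so both [f] and [g] fix it. *)
have st : (\top <= a (s i))%O = false.
  by rewrite le1x; exact (negbTE (insertion_nontop anti_s z)).
have tt : (\top <= a (t i))%O = false.
  by rewrite le1x; exact (negbTE (insertion_nontop anti_t z)).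
have Ccase u : u \in C -> (exists2 x, u = old K x & (x <= a (s i))%O || (x == \top%O))
    \/ exists z' : inner K i, u = new L z'.
  move=> uC; have := chC u _ uC zC; rewrite !insertion_leE //.
  case: u uC => [x|[j z']] uC /=; first by left; exists x.
  have [e _|ne] := eqVneq j i; last by [].
  by right; case: _ / e z uC {zC st tt f g} => z uC; exists z'.
have fK : {in C, cancel f g}.
  move=> u /Ccase[[x ->]|[z' ->] //] /orP[xs|/eqP->] /=; rewrite /f /g /lift_theta /=.
    by rewrite xs theta_le // thetaK.
  by rewrite st tt.
have gfC : g @: (f @: C) = C.
  rewrite -imset_comp -[RHS]imset_id; apply: eq_in_imset => u uC /=; exact: fK.
have newf i' (z' : inner K i') : (new L z' \in f @: C) = (new L z' \in C).
  apply/imsetP/idP => [[u uC]|z'C]; last by exists (new L z').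
  by have := uC; case: u {uC} => [x|zz] uC //= ->.
split.
- apply/is_chainP => _ _ /imsetP[u uC ->] /imsetP[v vC ->].
  suff mono u' v' : u' \in C -> v' \in C -> insertion_le K (a \o s) u' v' ->
      insertion_le K (a \o t) (f u') (f v').
    by have /orP[] := chC u v uC vC => /mono->; rewrite ?orbT.
  rewrite !insertion_leE // => /Ccase[[x -> xs]|[z1 ->]] /Ccase[[y -> ys]|[z2 ->]] //=.
  + case/orP: xs => [xs|/eqP->]; case/orP: ys => [ys|/eqP->] xy.
    * by rewrite xs ys theta_mono.
    * by rewrite st lex1.
    * by move: xy; rewrite le1x => /eqP yt; rewrite yt st in ys.
    * by rewrite st lexx.
  + by move=> xs'; rewrite xs' theta_le.
  + by move=> /eqP->; rewrite st.
- rewrite -/f (eq_pick (Q := has_new C)) => [|i']; first by rewrite pickC.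
  by rewrite /has_new; apply: eq_existsb => z'; rewrite newf.
exists f; split=> //; first exact: can_in_inj fK.
move=> u /Ccase[[x ->]|[z' ->] //]; rewrite /f /lift_theta /=.
by case/orP => [xs|/eqP->]; rewrite ?st // xs w_theta.
Qed.

End ChainMap.

(** * Coefficients of the invariant, and the isomorphisms [tau] as maps on [L] *)

(** The length [n] is separate from [#|E|] so that both matroids can be counted with tuples of one
    length. *)
Lemma coeff_G_invariant (E : finType) (M : matroid E) (F : fieldType) (n : nat) (v : seq nat) :
  n = #|E| ->
  coeff v (G_invariant M F) =
    (#|[set e : n.-tuple E | uniq e && (rank_seq M e == v)]|%:R)%R.
Proof.
move=> ->; rewrite /G_invariant raddf_sum /= -sum1dep_card natr_sum big_mkcondr.
apply: eq_bigr => e _.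
by rewrite coeffU mul1r; case: eqP.
Qed.

Section CyclicFlats.
Variables (E T : finType) (M : matroid E) (le : rel T) (phi : T -> cyclic_flats M).
Hypothesis phi_iso : order_iso le (@cyclic_flats_le E M) phi.

Lemma cyclic_flats_top (y1 : T) : (forall x, ~~ is_coloop M x) ->
  (forall y, le y y1) -> val (phi y1) = setT.
Proof.
move=> ncl top; have [psi _ psiK] := phi_iso.1.
pose X : cyclic_flats M := exist (fun Y => cyclic_flat M Y) _ (cyclic_flatT ncl).
apply/eqP; rewrite -subTset; have := top (psi X).
by rewrite -phi_iso.2 psiK.
Qed.

Lemma is_chain_flats (C : {set T}) : is_chain le C ->
  {in C &, forall G H, (val (phi G) \subset val (phi H)) || (val (phi H) \subset val (phi G))}.
Proof. by move=> /is_chainP chC G H GC HC; have := chC G H GC HC; rewrite -!phi_iso.2. Qed.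

End CyclicFlats.

(** [tau] and its inverse are extended by the identity to total functions on [L], which avoids
    dependent types in [chain_map]. *)
Lemma tau_extension (d : Order.disp_t) (L : finTBLatticeType d) (W : Type) (w : L -> W)
    (a0 a1 : L) (tau : interval_type \bot%O a0 -> interval_type \bot%O a1) :
  order_iso (@interval_le d L _ _) (@interval_le d L _ _) tau ->
  (forall y, w (val y) = w (val (tau y))) ->
  exists f : (L -> L) * (L -> L),
    [/\ forall x, (x <= a0)%O -> [/\ (f.1 x <= a1)%O, f.2 (f.1 x) = x & w (f.1 x) = w x],
        forall x, (x <= a1)%O -> (f.2 x <= a0)%O /\ f.1 (f.2 x) = x &
        forall x y, (x <= a0 -> y <= a0 -> (f.1 x <= f.1 y) = (x <= y))%O].
Proof.
move=> [[g tauK gK] tau_mono] wtau.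
pose emb (c x : L) (xc : (x <= c)%O) : interval_type \bot%O c :=
  exist (fun z => \bot <= z <= c)%O x (introT andP (conj (le0x x) xc)).
pose ext (c c' : L) (h : interval_type \bot%O c -> interval_type \bot%O c') x :=
  if insub x : option {z : L | \bot <= z <= c}%O is Some u then val (h u) else x.
have extE c c' h x (xc : (x <= c)%O) : @ext c c' h x = val (h (emb c x xc)).
  rewrite /ext; case: insubP => [u _ ux|]; last by rewrite le0x xc.
  by congr (val (h _)); apply: val_inj.
have valle (c : L) (u : interval_type \bot%O c) : (val u <= c)%O by have /andP[] := valP u.
have embK c (u : interval_type \bot%O c) uc : emb c (val u) uc = u by apply: val_inj.
exists (ext _ _ tau, ext _ _ g); split=> /= [x xa|x xa|x y xa ya].
- rewrite !(extE _ _ tau _ xa) (extE _ _ g _ (valle _ _)) embK tauK; split=> //.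
  by rewrite -wtau.
- rewrite !(extE _ _ g _ xa) (extE _ _ tau _ (valle _ _)) embK gK; split=> //.
- by rewrite !extE; apply: tau_mono.
Qed.

Theorem theorem4p1
  (F : fieldType) (charF : [pchar F]%R =i pred0)
  (d : Order.disp_t) (L : finTBLatticeType d)
  (m : nat) (a : 'I_m.+1 -> L) (a_inj : injective a)
  (b : L) (meet_a : forall i j : 'I_m.+1, i != j -> (a i `&` a j)%O = b)
  (tau : forall i : 'I_m.+1,
     interval_type \bot%O (a ord_max) -> interval_type \bot%O (a i))
  (tau_iso : forall i : 'I_m.+1, i != ord_max ->
     order_iso (@interval_le d L _ _) (@interval_le d L _ _) (tau i))
  (tau_fix : forall i : 'I_m.+1, i != ord_max ->
     forall y : interval_type \bot%O (a ord_max),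
     (val y <= b)%O -> val (tau i y) = val y)
  (n : nat) (dK : 'I_n -> Order.disp_t)
  (K : forall i, finTBLatticeType (dK i))
  (s t : 'I_n -> 'I_m.+1)
  (Es Et : finType) (Ms : matroid Es) (Mt : matroid Et)
  (Ms_loopless : forall x, ~~ is_loop Ms x)
  (Ms_coloopless : forall x, ~~ is_coloop Ms x)
  (Mt_loopless : forall x, ~~ is_loop Mt x)
  (Mt_coloopless : forall x, ~~ is_coloop Mt x)
  (phis : insertion L K -> cyclic_flats Ms)
  (phit : insertion L K -> cyclic_flats Mt)
  (phis_iso : order_iso (insertion_le K (fun i => a (s i)))
                        (@cyclic_flats_le Es Ms) phis)
  (phit_iso : order_iso (insertion_le K (fun i => a (t i)))
                        (@cyclic_flats_le Et Mt) phit)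
  (same_data : forall y : insertion L K,
     #|val (phis y)| = #|val (phit y)|
     /\ rk Ms (val (phis y)) = rk Mt (val (phit y)))
  (tau_data : forall i : 'I_m.+1, i != ord_max ->
     forall y : interval_type \bot%O (a ord_max),
     #|val (phis (old K (val y)))| = #|val (phis (old K (val (tau i y))))|
     /\ rk Ms (val (phis (old K (val y))))
        = rk Ms (val (phis (old K (val (tau i y)))))) :
  G_invariant Ms F = G_invariant Mt F.
Proof.
pose fs y := val (phis y); pose ft y := val (phit y).
pose ws := label fs (fun y => rk Ms (fs y)).
pose wt := label ft (fun y => rk Mt (ft y)).
have wst y : ws y = wt y by have [e1 e2] := same_data y; congr (_, _).
have anti_s := iso_anti phis_iso; have anti_t := iso_anti phit_iso.
have top_s (p : 'I_n -> L) : antisymmetric (insertion_le K p) ->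
    forall y, insertion_le K p y (old K \top%O).
  by move=> anti_p [x|z]; rewrite insertion_leE //= lex1.
have cardE : #|Es| = #|Et|.
  rewrite -!cardsT -(cyclic_flats_top phis_iso Ms_coloopless (top_s _ anti_s)).
  rewrite -(cyclic_flats_top phit_iso Mt_coloopless (top_s _ anti_t)).
  exact: (same_data _).1.
pose transfers i (g : (L -> L) * (L -> L)) :=
  [/\ forall x, (x <= a ord_max)%O ->
        [/\ (g.1 x <= a i)%O, g.2 (g.1 x) = x & ws (old K (g.1 x)) = ws (old K x)],
      forall x, (x <= a i)%O -> (g.2 x <= a ord_max)%O /\ g.1 (g.2 x) = x &
      forall x y, (x <= a ord_max -> y <= a ord_max -> (g.1 x <= g.1 y) = (x <= y))%O].
have [f fP] : exists f, forall i, transfers i (f i).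
  apply: (@fin_all_exists _ _ transfers) => i.
  have [->|im] := eqVneq i ord_max; first by exists (id, id); split.
  apply: (tau_extension (w := fun x => ws (old K x)) (tau_iso i im)) => y.
  by have [e1 e2] := tau_data i im y; congr (_, _).
(* Every passage between two intervals goes through the one below [a ord_max]. *)
pose theta j k x := (f k).1 ((f j).2 x).
have theta_le j k x : (x <= a j -> theta j k x <= a k)%O.
  have [_ fj _] := fP j; have [fk _ _] := fP k.
  by move=> /fj[/fk[]].
have thetaK j k x : (x <= a j)%O -> theta k j (theta j k x) = x.
  have [_ fj _] := fP j; have [fk _ _] := fP k.
  by rewrite /theta => /fj[/fk[_ -> _]].
have theta_mono j k x y : (x <= a j -> y <= a j -> x <= y -> theta j k x <= theta j k y)%O.
  have [_ fj mj] := fP j; have [_ _ mk] := fP k.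
  by move=> /fj[xm ex] /fj[ym ey]; rewrite /theta mk // -{1}ex -{1}ey mj.
have w_theta j k x : (x <= a j)%O -> ws (old K (theta j k x)) = ws (old K x).
  have [fj' fj _] := fP j; have [fk _ _] := fP k.
  move=> /fj[xm ex]; rewrite /theta; have [_ _ ->] := fk _ xm.
  by have [_ _] := fj' _ xm; rewrite ex.
have stP := chain_mapP theta_le thetaK theta_mono w_theta anti_s anti_t.
have tsP := chain_mapP theta_le thetaK theta_mono w_theta anti_t anti_s.
apply/eqP/freeg_eqP => v.
rewrite (coeff_G_invariant _ _ _ (erefl #|Es|)) (coeff_G_invariant _ _ _ cardE).
congr (_%:R)%R; apply/eqP; rewrite -eqz_nat.
rewrite (rank_seq_count _ _ phis_iso) (rank_seq_count _ _ phit_iso) /chainsum; apply/eqP.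
rewrite [RHS](reindex_onto (chain_map a theta s t) (chain_map a theta t s)) /=; last first.
  by move=> B /tsP[].
apply: eq_big => [A|A chA'].
  apply/idP/andP => [chA|[chB /eqP eA]].
    by have [chB eA _] := stP A chA; split; [exact: chB|exact/eqP].
  have [chA _ _] := tsP _ chB; rewrite -eA; exact: chA.
have [chA _ [h [eh injh wh]]] := stP A chA'.
(* The map [h] obtained for the whole chain [A] is used for all its subsets [C], including those
   without new elements; since it preserves labels, [C] and its image have equal counts. *)
rewrite eh altsum_imset //; apply: eq_altsum => C sCA; congr Posz.
have injC : {in C &, injective h} by move=> x y /(subsetP sCA) xA /(subsetP sCA); apply: injh.
have chC := is_chain_sub sCA chA'.
apply: (chain_count_transport _ _ _ cardE).
- exact: (is_chain_flats phis_iso chC).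
- apply: (is_chain_flats phit_iso); apply: is_chain_sub chA.
  by rewrite eh imsetS.
split=> [G GC|_ /imsetP[G GC ->]].
  by exists (h G); [rewrite imset_f|rewrite -[LHS]wst wh ?(subsetP sCA)].
by exists G; rewrite // -[RHS]wst wh ?(subsetP sCA).
Qed.
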